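(* For every $m\in\mathbb{N}$, the Minkowski dimension of $C_m$ exists and $$\dim_{\rm M} C_m=\frac12 .$$
   Context: $\mathbb{N}$ is the set of positive integers. Minkowski dimension: for a non-empty bounded set $\Omega\subset\mathbb{R}$ and $r>0$, let $\mathcal{N}_r(\Omega)$ be the smallest number of closed intervals of length $r$ needed to cover $\Omega$. Put $\overline{\dim}_{\rm M}\Omega=\limsup_{r\to0^+}\frac{\log \mathcal{N}_r(\Omega)}{-\log r}$ and $\underline{\dim}_{\rm M}\Omega=\liminf_{r\to0^+}\frac{\log \mathcal{N}_r(\Omega)}{-\log r}$. If they coincide, the common value is the Minkowski dimension $\dim_{\rm M}\Omega$. Continued fractions: let $T:[0,1)\to[0,1)$ be the Gauss map, $T(0)=0$ and $T(x)=\frac1x \pmod 1$ for $x\in(0,1)$. For $x\in(0,1)$ set $a_1(x)=\lfloor 1/x\rfloor$ and $a_n(x)=a_1(T^{n-1}x)$ for $n\ge2$ (as long as $T^{n-1}x\neq0$). For rational $x\in(0,1)$ this algorithm terminates and gives, for a unique $m\in\mathbb{N}$, $$x=[a_1,a_2,\ldots,a_m]=\cfrac{1}{a_1+\cfrac{1}{a_2+\cfrac{1}{\ddots+\cfrac1{a_m}}}},$$ with $a_i\in\mathbb{N}$ and last term $a_m\ge2$; this is the continued fraction of $x$, and $m$ is its length. The set $C_m$ is the set of all $x\in(0,1)\cap\mathbb{Q}$ whose continued fraction has length $m$. *)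

(* Defs.v *)
From HB Require Import structures.
From mathcomp Require Import all_boot all_order all_algebra.
From mathcomp Require Import all_classical all_reals all_analysis.

Set Implicit Arguments.
Unset Strict Implicit.
Unset Printing Implicit Defensive.

Import Order.TTheory GRing.Theory Num.Theory.
Import numFieldNormedType.Exports.

Local Open Scope classical_set_scope.
Local Open Scope ring_scope.

Section minkowski.
Context {R : realType}.
Implicit Types (A : set R) (r d : R) (n : nat).

Definition covered_by A r n : Prop :=
  exists c : 'I_n -> R, A `<=` \bigcup_i `[c i, c i + r]%classic.

(* For bounded A and r > 0 the least element exists and is unique; otherwise
   the default 0 may be returned. *)
Definition covering_number A r : nat :=
  xget 0%N [set n | covered_by A r n /\ forall k, covered_by A r k -> (n <= k)%N].

Definition covering_ratio A r : \bar R :=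
  (ln (covering_number A r)%:R / - ln r)%:E.

Definition upper_minkowski_dim A : \bar R := limf_esup (covering_ratio A) 0^'+.

Definition lower_minkowski_dim A : \bar R := limf_einf (covering_ratio A) 0^'+.

(* The Minkowski dimension is only defined for non-empty bounded sets, so being
   such a set is part of having one. *)
Definition has_minkowski_dim A d : Prop :=
  [/\ A !=set0, bounded_set A,
      upper_minkowski_dim A = d%:E & lower_minkowski_dim A = d%:E].

End minkowski.

Section continued_fraction.
Context {R : realType}.
Implicit Types (x : R) (s : seq nat) (m : nat).

Definition gauss_map x : R :=
  if x == 0 then 0 else x^-1 - (Num.floor x^-1)%:~R.

Definition partial_quotient x : nat := Num.truncn x^-1.

(* The algorithm started at x stops after exactly size s steps and outputs s;
   nth 0 s i is the partial quotient a_(i+1). *)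
Definition is_continued_fraction x s : Prop :=
  (forall i, (i < size s)%N ->
     iter i gauss_map x != 0 /\
     nth 0%N s i = partial_quotient (iter i gauss_map x)) /\
  iter (size s) gauss_map x = 0.

Definition cf_length_set m : set R :=
  [set x | [/\ 0 < x, x < 1, rational x &
               exists2 s, is_continued_fraction x s & size s = m]].

End continued_fraction.

Arguments cf_length_set R m : clear implicits.

(* Main.v *)
(* Write [r = u^-2] and split by the first partial quotient. Points with first
   quotient above [u] lie in [0, 1/u], which needs about [u] intervals of
   length [r]. The branch [t |-> 1/(k+t)] contracts by [k^-2], so for [k <= u]
   a cover of the set of length one less by intervals of length [(u/k)^-2]
   yields one by intervals of length [r]. Summing [(u/k) (1 + ln u)^m] over
   [k <= u] costs one more logarithm, so the covering number is
   [O(u (1 + ln u)^m)] by induction. Conversely, for fixed [t] the points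
   [1/(k+t)] with [k] up to about [u] are more than [u^-2] apart. *)
Require Import Defs.
From mathcomp Require Import all_boot all_order all_algebra.
From mathcomp Require Import all_classical all_reals all_analysis.
From mathcomp Require Import ring lra zify.

Import Order.TTheory GRing.Theory Num.Theory.
Import numFieldNormedType.Exports.

Local Open Scope ring_scope.

(* [mathcomp.analysis] has another [covered_by], which shadows the one of [Defs]. *)
Local Notation covered_by := Defs.covered_by.

(** * Covering numbers of subsets of the line *)

Section covering.
Local Open Scope classical_set_scope.
Context {R : realType}.
Implicit Types (A B : set R) (r u x : R) (n k : nat).

Lemma covered_byS A B r n : A `<=` B -> covered_by B r n -> covered_by A r n.
Proof. by move=> AB [c Bc]; exists c; exact: subset_trans Bc. Qed.

Lemma covered_by0 r : covered_by set0 r 0.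
Proof. by exists (fun=> 0) => x. Qed.

Lemma covered_byU A B r n k :
  covered_by A r n -> covered_by B r k -> covered_by (A `|` B) r (n + k).
Proof.
move=> [c Ac] [d Bd].
exists (fun i : 'I_(n + k) => match fintype.split i with inl j => c j | inr j => d j end).
move=> x [/Ac[i _ xi]|/Bd[i _ xi]].
  exists (lshift k i) => //; have -> // : fintype.split (lshift k i) = inl i.
  exact: (unsplitK (inl i)).
exists (rshift n i) => //; have -> // : fintype.split (rshift n i) = inr i.
exact: (unsplitK (inr i)).
Qed.

Lemma covered_by_bigcup (A : nat -> set R) r (b : nat -> R) n :
  (forall i, (i < n)%N -> exists2 k, covered_by (A i) r k & k%:R <= b i) ->
  exists2 k, covered_by (\bigcup_(i in `I_n) A i) r k &
             k%:R <= \sum_(i < n) b i.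
Proof.
elim: n => [_|n IH Ab].
  exists 0%N; last by rewrite big_ord0.
  by apply: covered_byS (covered_by0 r) => x [].
have [k Ak kb] : exists2 k, covered_by (\bigcup_(i in `I_n) A i) r k &
    k%:R <= \sum_(i < n) b i.
  by apply: IH => i ni; apply: Ab; rewrite ltnS ltnW.
have [l Al lb] := Ab n (ltnSn n).
exists (k + l)%N; last by rewrite big_ord_recr natrD lerD.
apply: covered_byS (covered_byU _ _ _ _ _ Ak Al) => x [i /=].
rewrite ltnS leq_eqVlt => /predU1P[->|ni] xi; first by right.
by left; exists i.
Qed.

Lemma covered_by_itv (b r : R) : 0 < r ->
  covered_by `[0, b] r (Num.truncn (b / r)).+1.
Proof.
move=> r0; exists (fun i => i%:R * r) => x; rewrite /= in_itv /= => /andP[x0 xb].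
have xr0 : 0 <= x / r by rewrite divr_ge0 // ltW.
have xK : (Num.truncn (x / r) < (Num.truncn (b / r)).+1)%N.
  by rewrite ltnS le_truncn // ler_pM2r ?invr_gt0.
exists (Ordinal xK) => //=; rewrite in_itv /=.
have /andP[lo hi] := truncn_itv xr0.
rewrite -ler_pdivlMr // lo /=.
by rewrite -[X in _ + X]mul1r -mulrDl natr1 -ler_pdivrMr // ltW.
Qed.

Lemma subrVV (x y : R) : 0 < x -> 0 < y -> x^-1 - y^-1 = (y - x) / (x * y).
Proof. by move=> x0 y0; field; rewrite !gt_eqF. Qed.

(** For [0 <= s <= t], the difference [1/(k+s) - 1/(k+t) = (t-s)/((k+s)(k+t))] is at most
    [(t-s)/k^2]. *)
Lemma covered_by_inv_shift A r n k : (0 < k)%N ->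
  A `<=` [set t | 0 <= t] -> covered_by A (r * k%:R ^+ 2) n ->
  covered_by ((fun t => (k%:R + t)^-1) @` A) r n.
Proof.
(* The branch is decreasing, so left endpoints turn into right ones, whence the [- r]. Clipping
   [c i] at 0 keeps the denominator positive. *)
move=> k0 A0 [c Ac]; exists (fun i => (k%:R + Num.max (c i) 0)^-1 - r).
move=> _ [t At <-]; have [i _ /=] := Ac t At; rewrite in_itv /= => /andP[ct tc].
exists i => //=; rewrite in_itv /= subrK; have t0 : 0 <= t := A0 _ At.
have k1 : 0 < k%:R :> R by rewrite ltr0n.
set c0 := Num.max (c i) 0.
have c00 : 0 <= c0 by rewrite le_max lexx orbT.
have c0t : c0 <= t by rewrite ge_max ct t0.
have tc0 : t - c0 <= r * k%:R ^+ 2.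
  by rewrite lerBlDl (le_trans tc) // lerD2r le_max lexx.
have kc : 0 < k%:R + c0 by lra.
have kt : 0 < k%:R + t by lra.
rewrite lef_pV2 ?posrE // lerD2l c0t andbT lerBlDl -lerBlDr.
rewrite subrVV // opprD addrACA subrr add0r.
rewrite ler_pdivrMr ?mulr_gt0 // (le_trans tc0) //.
(* The sign of [r] is read off the cover, as [0 <= t - c0 <= r * k^2]. *)
have r0 : 0 <= r by rewrite -(pmulr_lge0 _ (exprn_gt0 2 k1)) (le_trans _ tc0) // subr_ge0.
by rewrite ler_wpM2l // expr2 ler_pM ?lerDl // ltW.
Qed.

(** Pigeonhole: an interval of length [r] holds at most one of the points. *)
Lemma leq_covered_by_separated A r n k (p : 'I_n -> R) :
  (forall i, A (p i)) -> (forall i j : 'I_n, (i < j)%N -> r < `|p i - p j|) ->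
  covered_by A r k -> (n <= k)%N.
Proof.
move=> Ap psep [c Ac].
have /choice[f fP] i : exists l, `[c l, c l + r] (p i).
  by have [l _ ?] := Ac _ (Ap i); exists l.
have near_p i j : f i = f j -> `|p i - p j| <= r.
  move=> fij; have := fP i; have := fP j.
  rewrite fij /= !in_itv /= => /andP[? ?] /andP[? ?]; rewrite ler_norml; lra.
rewrite -(card_ord n) -(card_ord k); apply: (leq_card f) => i j fij.
apply: val_inj; have [ij|ji|//] := ltngtP i j.
- by have := psep _ _ ij; rewrite ltNge near_p.
- by have := psep _ _ ji; rewrite ltNge near_p.
Qed.

(** One finite cover makes a least size exist, so [xget] does not fall back on its default. *)
Lemma covering_numberP A r n : covered_by A r n ->
  covered_by A r (covering_number A r) /\ (covering_number A r <= n)%N.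
Proof.
move=> An; rewrite /covering_number.
set P := [set _ | _]; suff [? min] : P (xget 0%N P) by split=> //; exact: min.
apply: xgetPex; have exA : exists n, `[< covered_by A r n >].
  by exists n; apply/asboolP.
case: (ex_minnP exA) => l /asboolP Al lmin; exists l; split=> // j Aj.
by apply: lmin; apply/asboolP.
Qed.

End covering.

(** * Upper and lower limits, and the dimension from two-sided bounds *)

Section limits.
Local Open Scope classical_set_scope.
Context {R : realType}.

(** The set where [f <= l + e] belongs to [F] and bounds the infimum of suprema from above. Since
    [F] is proper, each of its members meets the set where [l - e <= f], which gives the other
    inequality. *)
Lemma cvg_limf_esup {T : choiceType} {X : filteredType T} (F : set_system X)
    {FF : ProperFilter F} (f : X -> R) (l : R) :
  f x @[x --> F] --> l -> limf_esup (fun x => (f x)%:E) F = l%:E.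
Proof.
move=> fl; rewrite limf_esupE; apply/eqP; rewrite eq_le; apply/andP; split.
  apply/lee_addgt0Pr => e e0.
  apply: ge_ereal_inf; exists (ereal_sup ((fun x => (f x)%:E) @` [set x | f x <= l + e])).
    exists [set x | f x <= l + e] => //.
    by have := (cvgr_le _ fl _ _); apply; rewrite ltrDl.
  by apply: ge_ereal_sup => _ [x fx <-]; rewrite -EFinD lee_fin.
apply: le_ereal_inf_tmp => _ [V FV <-]; apply/lee_addgt0Pr => e e0.
have FW : F [set x | l - e <= f x].
  by have := (cvgr_ge _ fl _ _); apply; rewrite ltrBlDr ltrDl.
have [x [Vx fx]] := filter_ex (filterI FV FW).
rewrite -leeBlDr // -EFinB; apply: le_ereal_sup_tmp; exists (f x)%:E.
  by exists x.
by rewrite lee_fin.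
Qed.

Lemma cvg_limf_einf {T : choiceType} {X : filteredType T} (F : set_system X)
    {FF : ProperFilter F} (f : X -> R) (l : R) :
  f x @[x --> F] --> l -> limf_einf (fun x => (f x)%:E) F = l%:E.
Proof.
move=> fl; rewrite /limf_einf -[RHS]oppeK; congr (- _)%E.
by rewrite -EFinN -(cvg_limf_esup F (fun x => - f x)) //; exact: cvgN.
Qed.

(* The tangent line to [ln] at [a^-1] with [a] small gives a linear bound of
   small slope. *)
Lemma ln_le_linear (a x : R) : 0 < a -> 0 < x -> ln x <= a * x - ln a.
Proof.
move=> a0 x0; rewrite lerBrDr addrC -lnM ?posrE // ltW // ln_sublinear //.
exact: mulr_gt0.
Qed.

Lemma near_affine_ln_le (b d e : R) : 0 <= d -> 0 < e ->
  (* The slope [a] gives [d * a <= e / 2], and [d + 1] avoids a division by 0. Half of [e * x]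
     absorbs the linear term, the other half the constants. *)
  \forall x \near +oo, b + d * ln (1 + x) <= e * x.
Proof.
move=> d0 e0; pose a := e / 2 / (d + 1).
have d1 : 0 < d + 1 by rewrite ltr_wpDl.
have a0 : 0 < a by rewrite !divr_gt0.
have da : d * a <= e / 2.
  rewrite /a mulrCA ler_piMr //; first lra.
  by rewrite ler_pdivrMr //; lra.
near=> x.
have x0 : 0 <= x by near: x; apply: nbhs_pinfty_ge; exact: num_real.
have xM : (b + d * (a - ln a)) / (e / 2) <= x by near: x; apply: nbhs_pinfty_ge; exact: num_real.
have := ln_le_linear a (1 + x) a0 _; rewrite ltr_pwDl // => /(_ isT) lnx.
have := ler_wpM2l d0 lnx.
have := ler_wpM2r x0 da.
move: xM; rewrite ler_pdivrMr ?divr_gt0 //.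
lra.
Unshelve. all: by end_near. Qed.

(** After taking logarithms and dividing by [- ln r], the constants and the logarithmic factor
    contribute only [o(1)]. *)
Lemma has_minkowski_dim_of_bounds (A : set R) (d c C : R) (m : nat) :
  A !=set0 -> bounded_set A -> 0 < c -> 0 < C ->
  (\forall r \near 0^'+,
     c * r `^ (- d) <= (covering_number A r)%:R
       <= C * r `^ (- d) * (1 - ln r) ^+ m) ->
  has_minkowski_dim A d.
Proof.
move=> A0 Ab c0 C0 Nr.
suff lim : ln (covering_number A r)%:R / - ln r @[r --> 0^'+] --> d.
  by split=> //; [exact: cvg_limf_esup|exact: cvg_limf_einf].
have lny : - ln r @[r --> (0 : R)^'+] --> +oo by apply/cvgNry; exact: lnNy.
have /cvgryPgt/(_ 0) ln_lt0 := lny.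
apply/cvgrPdist_le => e e0.
have near_up : \forall r \near 0^'+, ln C + m%:R * ln (1 - ln r) <= e * - ln r.
  exact: lny _ (near_affine_ln_le (ln C) m%:R e (ler0n _ _) e0).
(* The lower bound has no logarithmic factor, hence the coefficient 0. *)
have near_dn : \forall r \near 0^'+, - ln c + 0 * ln (1 - ln r) <= e * - ln r.
  exact: lny _ (near_affine_ln_le (- ln c) 0 e (lexx _) e0).
near=> r.
have r0 : 0 < r by near: r; exact: nbhs_right_gt.
have L0 : 0 < - ln r by near: r.
have p0 : 0 < r `^ (- d) by rewrite powR_gt0.
have /andP[lo hi] : c * r `^ (- d) <= (covering_number A r)%:R
    <= C * r `^ (- d) * (1 - ln r) ^+ m by near: r.
have L1 : 0 < 1 - ln r by lra.
have N0 : 0 < (covering_number A r)%:R :> R.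
  by apply: lt_le_trans lo; rewrite mulr_gt0.
have up : ln C + m%:R * ln (1 - ln r) <= e * - ln r by near: r.
have dn : - ln c + 0 * ln (1 - ln r) <= e * - ln r by near: r.
have {}lo : ln c - d * ln r <= ln (covering_number A r)%:R.
  by rewrite -mulNr -ln_powR -lnM ?posrE // ler_ln ?posrE // mulr_gt0.
have {}hi : ln (covering_number A r)%:R <=
    ln C - d * ln r + m%:R * ln (1 - ln r).
  have q0 : 0 < (1 - ln r) ^+ m by rewrite exprn_gt0.
  rewrite mulr_natl -lnXn // -mulNr -ln_powR -!lnM ?posrE ?mulr_gt0 //.
  by rewrite ler_ln ?posrE ?mulr_gt0.
rewrite distrC ler_distl ler_pdivlMr // ler_pdivrMr //.
by apply/andP; split; lra.
Unshelve. all: by end_near. Qed.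

End limits.

(** * The Gauss map, its inverse branches, and the two covering bounds *)

Section gauss.
Local Open Scope classical_set_scope.
Context {R : realType}.
Implicit Types (t x u : R) (m n k : nat).

Lemma gauss_map_itv x : 0 <= x -> 0 <= gauss_map x < 1.
Proof.
move=> x0; rewrite /gauss_map; case: ifP => [_|_]; first by rewrite lexx ltr01.
by rewrite subr_ge0 ge_floor ltrBlDl -intrD1 floorD1_gt.
Qed.

Lemma gauss_map_inv_shift t k : 0 <= t < 1 -> (0 < k)%N ->
  gauss_map (k%:R + t)^-1 = t.
Proof.
move=> /andP[t0 t1] k0; have kt : 0 < k%:R + t by rewrite ltr_pwDl ?ltr0n.
rewrite /gauss_map invr_eq0 gt_eqF // invrK.
have -> : Num.floor (k%:R + t) = k%:Z.
  by apply: floor_def; rewrite intrD /= lerDl t0 ltrD2l.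
by rewrite addrC addKr.
Qed.

Lemma inv_shift_gauss_map x : 0 < x ->
  x = ((Num.truncn x^-1)%:R + gauss_map x)^-1.
Proof.
move=> x0; have xV : 0 <= x^-1 by rewrite invr_ge0 ltW.
rewrite /gauss_map gt_eqF // truncn_floor xV.
by rewrite natr_absz ger0_norm ?floor_ge0 // addrC subrK invrK.
Qed.

(* As [gauss_map 0 = 0], this also contains [0] and the shorter continued
   fractions, so that every branch lands in the same set. *)
Definition terminating m : set R :=
  [set x | 0 <= x < 1 /\ iter m gauss_map x = 0].

Lemma terminating_cover m u : 0 < u ->
  terminating m.+1 `<=` `[0, u^-1] `|`
    \bigcup_(i in `I_(Num.truncn u))
      ((fun t => (i.+1%:R + t)^-1) @` terminating m).
Proof.
move=> u0 x [/andP[x0 x1]]; rewrite iterSr => xm.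
have [xu|ux] := leP x u^-1; first by left; rewrite /= in_itv /= x0.
have {}x0 : 0 < x by apply: lt_trans ux; rewrite invr_gt0.
have xu : x^-1 <= u by rewrite -[u]invrK lef_pV2 ?posrE ?invr_gt0 // ltW.
have x11 : 1 <= x^-1 by rewrite invf_ge1 // ltW.
right; have := truncn_gt0 x^-1; rewrite x11 => k0.
(* Indices start at 0, so the first quotient [k] has index [k - 1]. *)
exists (Num.truncn x^-1).-1 => /=.
  by rewrite prednK // le_truncn.
exists (gauss_map x); last by rewrite prednK // -inv_shift_gauss_map.
by split=> //; apply: gauss_map_itv; exact: ltW.
Qed.

(** Each new term satisfies [1/(n+2) <= ln (n+2) - ln (n+1)], by [ln (1 + y) <= y] at
    [y = -1/(n+2)]. *)
Lemma sum_inv_le_ln n : \sum_(i < n.+1) i.+1%:R^-1 <= 1 + ln n.+1%:R :> R.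
Proof.
elim: n => [|n IH]; first by rewrite big_ord1 ln1 invr1 addr0.
rewrite big_ord_recr /= (le_trans (lerD IH (lexx _))) // -addrA lerD2l.
have n0 : 0 < n.+1%:R :> R by rewrite ltr0n.
have n1 : 0 < n.+2%:R :> R by rewrite ltr0n.
have q : n.+1%:R / n.+2%:R = 1 + - n.+2%:R^-1 :> R.
  by rewrite -[n.+1%:R](addrK 1) natr1 mulrBl divff ?gt_eqF // mul1r.
have := @le_ln1Dx R (- n.+2%:R^-1).
rewrite -q ltrN2 invf_lt1 // ltr1n => /(_ isT).
by rewrite ln_div ?posrE // lerBlDr [- _ + _]addrC lerBrDr.
Qed.

(** The constant is uniform in [u], so that the induction hypothesis applies at [u / k] for every
    branch [k <= u]. *)
Lemma covered_by_terminating m : exists2 C : R, 0 < C &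
  forall u, 1 <= u -> exists2 n, covered_by (terminating m) (u ^- 2) n &
                                 n%:R <= C * u * (1 + ln u) ^+ m.
Proof.
elim: m => [|m [C C0 IH]].
  exists 1 => // u u1; exists 1%N; last by rewrite mul1r expr0 mulr1.
  exists (fun=> 0) => x [_ /= ->]; exists ord0 => //=.
  by rewrite in_itv /= lexx add0r invr_ge0 exprn_ge0 // (le_trans ler01).
(* The branches contribute [C]. The interval [[0, 1/u]] takes [K + 1 <= 2 * u] pieces, whence the
   2. *)
exists (C + 2); first lra.
move=> u u1; have u0 : 0 < u by lra.
have lnu : 0 <= ln u by rewrite ln_ge0.
pose K := Num.truncn u.
have K0 : (0 < K)%N by rewrite truncn_gt0.
have Ku : K%:R <= u by rewrite truncn_le ltW.
have [i iK|k Ak kb] := covered_by_bigcup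
  (fun i => (fun t => (i.+1%:R + t)^-1) @` terminating m) (u ^- 2)
  (fun i => C * u * (1 + ln u) ^+ m * i.+1%:R^-1) K.
  have i0 : 0 < i.+1%:R :> R by rewrite ltr0n.
  have iu : 1 <= u / i.+1%:R.
    by rewrite ler_pdivlMr // mul1r (le_trans _ Ku) // ler_nat.
  have [n An nb] := IH _ iu; exists n.
    apply: covered_by_inv_shift => //; first by move=> t [/andP[]].
    by move: An; rewrite expr_div_n invf_div mulrC.
  (* Replacing [ln (u / k)] by [ln u] leaves [1/k] as the only dependence on the branch. *)
  rewrite (le_trans nb) // [leRHS]mulrAC mulrA ler_wpM2l //.
    by rewrite -mulrA mulr_ge0 ?divr_ge0 // ltW.
  rewrite lerXn2r ?nnegrE //; first by rewrite addr_ge0 // ln_ge0.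
    by rewrite addr_ge0.
  rewrite lerD2l ler_ln ?posrE // ?divr_gt0 //.
  by rewrite ler_pdivrMr // ler_peMr ?ler1n // ltW.
have uV : 0 < u ^- 2 by rewrite invr_gt0 exprn_gt0.
exists ((Num.truncn (u^-1 / u ^- 2)).+1 + k)%N.
  apply: covered_byS (covered_byU _ _ _ _ _ (covered_by_itv u^-1 _ uV) Ak).
  exact: terminating_cover.
have -> : u^-1 / u ^- 2 = u by field; rewrite gt_eqF.
have e1 : 1 <= (1 + ln u) ^+ m.+1 by rewrite exprn_ege1 // lerDl.
have em : 0 <= (1 + ln u) ^+ m by rewrite exprn_ge0 // addr_ge0.
rewrite natrD -natr1 -/K 2!mulrDl addrC lerD //; last first.
  have := ler_wpM2l (ltW u0) e1; lra.
(* The harmonic sum up to [K <= u] supplies the additional factor [1 + ln u]. *)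
rewrite (le_trans kb) // -mulr_sumr exprSr mulrA ler_wpM2l //.
  by rewrite !mulr_ge0 // ltW.
rewrite -(prednK K0) (le_trans (sum_inv_le_ln _)) // prednK // lerD2l.
by rewrite ler_ln ?posrE // ltr0n.
Qed.

(** The quotients are determined by the orbit, so the length is just the time at which the orbit
    first hits 0. *)
Lemma cf_length_setSP m x :
  cf_length_set R m x <->
  [/\ 0 < x, x < 1, rational x, iter m gauss_map x = 0 &
      forall i, (i < m)%N -> iter i gauss_map x != 0].
Proof.
split=> [[x0 x1 xQ [s [sP sE] <-]]|[x0 x1 xQ xm xi]].
  by split=> // i /sP[].
split=> //; exists (mkseq (fun i => partial_quotient (iter i gauss_map x)) m).
  split; rewrite size_mkseq // => i im.
  by rewrite nth_mkseq // xi.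
exact: size_mkseq.
Qed.

Lemma cf_length_set_terminating m : cf_length_set R m `<=` terminating m.
Proof. by move=> x /cf_length_setSP[x0 x1 _ xm _]; rewrite /terminating /= ltW. Qed.

(** Prepending the quotient [k] adds one step. Taking [1 < k] keeps the point below 1 even when
    [t = 0]. *)
Lemma inv_shift_cf_length m t k : (1 < k)%N -> 0 <= t < 1 -> rational t ->
  iter m gauss_map t = 0 -> (forall i, (i < m)%N -> iter i gauss_map t != 0) ->
  cf_length_set R m.+1 (k%:R + t)^-1.
Proof.
move=> k1 t01 [q _ qt] tm ti; have k0 := ltnW k1.
have [t0 t1] := andP t01.
have kt : 1 < k%:R + t by rewrite ltr_wpDr // ltr1n.
apply/cf_length_setSP; split.
- by rewrite invr_gt0 (lt_trans ltr01).
- by rewrite invf_lt1 // (lt_trans ltr01).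
- by exists (k%:R + q)^-1 => //; rewrite fmorphV rmorphD /= ratr_nat qt.
- by rewrite iterSr gauss_map_inv_shift.
- case=> [_|i im]; first by rewrite /= invr_eq0 gt_eqF // (lt_trans ltr01).
  by rewrite iterSr gauss_map_inv_shift // ti.
Qed.

(** Starting from 0, the branch [k = 2] is applied [m] times, giving [[2, ..., 2]]. *)
Lemma exists_length m : exists t : R,
  [/\ 0 <= t < 1, rational t, iter m gauss_map t = 0 &
      forall i, (i < m)%N -> iter i gauss_map t != 0].
Proof.
elim: m => [|m [t [t01 tQ tm ti]]].
  by exists 0; split; rewrite ?lexx ?ltr01 //; exists 0; rewrite // rmorph0.
have /cf_length_setSP[? ? ? ? ?] := inv_shift_cf_length m t 2 isT t01 tQ tm ti.
by exists (2%:R + t)^-1; split=> //; rewrite ltW.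
Qed.

(** The quotients used run from 2 to [truncn u - 1]: then [k + t < u], and two of the points differ
    by more than [1/u^2]. *)
Lemma leq_covered_by_cf_length m u k :
  covered_by (cf_length_set R m.+1) (u ^- 2) k -> ((Num.truncn u).-2 <= k)%N.
Proof.
have [t [t01 tQ tm ti]] := exists_length m.
have /andP[t0 t1] := t01.
apply: (leq_covered_by_separated _ _ _ _ (fun i => (i.+2%:R + t)^-1)).
  by move=> i; exact: inv_shift_cf_length.
move=> i j ij.
have small (l : 'I_(Num.truncn u).-2) : l.+2%:R + t < u.
  have lu : (l.+2 < Num.truncn u)%N by have := ltn_ord l; lia.
  by rewrite truncn_gt_nat in lu; apply: lt_le_trans lu; rewrite -[ltRHS]natr1 ltrD2l.
have pos (l : nat) : 0 < l.+2%:R + t by rewrite ltr_pwDl // ltr0n.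
have u0 : 0 < u := lt_trans (pos i) (small i).
have ij1 : 1 <= j.+2%:R - i.+2%:R :> R.
  by rewrite lerBrDr addrC natr1 ler_nat !ltnS.
apply: lt_le_trans (ler_norm _).
rewrite subrVV // opprD addrACA subrr addr0.
rewrite ltr_pdivlMr ?mulr_gt0 // (lt_le_trans _ ij1) //.
rewrite mulrC ltr_pdivrMr ?exprn_gt0 // mul1r expr2.
by rewrite ltr_pM ?small // ltW.
Qed.

End gauss.

Theorem theorem1p1 (R : realType) (m : nat) (hm : (0 < m)%N) :
  has_minkowski_dim (cf_length_set R m) (1 / 2).
Proof.
case: m hm => // m _.
have [C C0 covC] := @covered_by_terminating R m.+1.
have [t [t01 tQ tm ti]] := @exists_length R m.
apply: (has_minkowski_dim_of_bounds _ _ (1 / 2) C m.+1) => //.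
- by exists (2%:R + t)^-1; exact: inv_shift_cf_length.
- exists 1; split; first exact: num_real.
  move=> M M1 x [x0 x1 _ _] /=; rewrite gtr0_norm //.
  exact: ltW (lt_trans x1 M1).
near=> r.
have r0 : 0 < r by near: r; exact: nbhs_right_gt.
(* This threshold amounts to [u > 6], which the lower bound with constant [1/2] relies on. *)
have r1 : r < 1 / 36 by near: r; apply: nbhs_right_lt; lra.
set u := r `^ (- (1 / 2)).
have u0 : 0 < u by rewrite powR_gt0.
have uE : u ^- 2 = r.
  rewrite /u -powR_mulrn ?ltW // -powRrM -powRN.
  by rewrite (_ : - _ = 1) ?powRr1 ?ltW //; lra.
have u6 : 6 < u.
  rewrite -(@ltr_pXn2r _ 2) ?nnegrE ?ltW //.
  by rewrite -[ltRHS]invrK uE -(@invrK _ (6 ^+ 2)) ltf_pV2 ?posrE ?invr_gt0 //; lra.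
(* Here [ln u] is half of [- ln r], and [- ln r] is nonnegative. *)
have lnu : ln u <= - ln r.
  rewrite ln_powR; have : ln r <= 0 by rewrite ln_le0 //; lra.
  lra.
have lnu0 : 0 <= ln u by rewrite ln_ge0 //; lra.
have [|n /(covered_byS _ _ _ _ (cf_length_set_terminating _)) An nb] := covC u.
  by lra.
rewrite uE in An; have [AN Nn] := covering_numberP _ _ _ An.
apply/andP; split.
  (* From [u < truncn u + 1] and [u > 6] follows [truncn u - 2 > u - 3 > u / 2]. *)
  rewrite -uE in AN *; have := leq_covered_by_cf_length _ _ _ AN.
  rewrite -(ler_nat R); apply: le_trans.
  have := truncnS_gt u; have T2 : (2 <= Num.truncn u)%N.
    by rewrite truncn_ge_nat ?(ltW u0) //; lra.
  rewrite -[X in X.+1](subnK T2) -subn2 -addnS natrD; lra.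
rewrite (le_trans (y := n%:R)) ?ler_nat // (le_trans nb) //.
rewrite ler_wpM2l //; first by rewrite mulr_ge0 // ltW.
rewrite lerXn2r ?nnegrE //; lra.
Unshelve. all: by end_near. Qed.
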